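(* Let $F$ be a $4$-regular graph, let $P$ be a circuit partition of $F$, let $D$ be a directed version of $\mathrm{Tch}(P)$, and let $B$ be a strictly fundamental cycle basis of $F$. Then $\mathrm{CM}(\mathrm{Tch}(P),\pi_P(B),D)$ is totally unimodular.
   Context: Graphs: $G=(V,H,E,\epsilon)$ with finite sets of vertices $V$ and half-edges $H$, a partition $E$ of $H$ into unordered pairs (edges), and $\epsilon:H\to V$; loops and multiple edges allowed. A directed version orders each edge as (tail, head). A single transition is an unordered pair of distinct half-edges incident with a common vertex; a directed single transition is such an ordered pair. A closed walk is a sequence $((h_1,h_2),\dots,(h_{n-1},h_n))$ of directed single transitions with $\{h_2,h_3\},\{h_4,h_5\},\dots,\{h_n,h_1\}$ edges, up to cyclic shift. $\sigma(D,W)\in\mathbb Z^{E}$ counts, at each edge, traversals by $W$ along its direction in $D$ minus traversals against it. An oriented circuit is a nonempty closed walk in which each half-edge occurs at most once; a circuit is one with orientation forgotten. For a maximal forest $T$ of $G$ and an edge $e\notin T$, the fundamental circuit of $e$ is the unique circuit whose only edge outside $T$ is $e$; a strictly fundamental cycle basis w.r.t. $T$ is the set of these fundamental circuits, each given an arbitrary orientation. For a (multi)set $\Gamma$ of closed walks, $\mathrm{CM}(G,\Gamma,D)$ is the $\Gamma\times E(G)$ matrix whose row indexed by $W$ is $\sigma(D,W)$. A matrix is totally unimodular if every square submatrix has determinant in $\{-1,0,1\}$. $F$ is $4$-regular if every vertex is incident with exactly $4$ half-edges. A transition at $v$ is a partition of the four half-edges at $v$ into two single transitions. A circuit partition $P$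 is a set of circuits of $F$ such that every half-edge lies in exactly one single transition of exactly one circuit of $P$; $\tau(P)$ is the set of transitions both of whose single transitions occur in circuits of $P$. The touch-graph $\mathrm{Tch}(P)$ has vertex set $P$, half-edge set the set of single transitions occurring in circuits of $P$, edge set $\tau(P)$, and maps each single transition to the circuit containing it. For a closed walk $W$ of $F$, $\pi_P(W)$ is obtained by replacing each directed single transition $(h,h')$ of $W$ by $(s,s')$, where $s,s'$ are the single transitions of circuits of $P$ containing $h,h'$, and deleting pairs with $s=s'$; it is a closed walk of $\mathrm{Tch}(P)$ in which each remaining $(s,s')$ traverses edge $\{s,s'\}$ from half-edge $s$ to half-edge $s'$. $\pi_P(B)$ is the multiset $\{\pi_P(W):W\in B\}$ (rows indexed by $B$). *)

(* Defs.v *)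
From mathcomp Require Import all_boot all_order all_algebra.
Set Implicit Arguments.
Unset Strict Implicit.
Unset Printing Implicit Defensive.
Import GRing.Theory Num.Theory.

(* Graphs in the half-edge model.  A graph G = (V, H, E, eps) is encoded by
   a set of half-edges Hs : {set H}, a set of edges E : {set {set H}} that is a
   partition of Hs into 2-element blocks (unordered pairs), and eps : H -> V.
   For the graph F of the theorem, Hs = [set: H]. *)

Section Graphs.
Context {V : finType} {H : finType}.

Definition is_graph (Hs : {set H}) (E : {set {set H}}) : bool :=
  partition E Hs && [forall e in E, #|e| == 2].

Definition four_regular (eps : H -> V) : Prop :=
  forall v : V, #|[set h | eps h == v]| = 4.

Definition dst (Hs : {set H}) (eps : H -> V) (p : H * H) : bool :=
  [&& p.1 \in Hs, p.2 \in Hs, p.1 != p.2 & eps p.1 == eps p.2].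

(* For W = ((h1,h2),...,(h_{n-1},h_n)), the edge traversals
   (h2,h3), (h4,h5), ..., (hn,h1): edge {h_{2i},h_{2i+1}} traversed from
   h_{2i} to h_{2i+1}. *)
Definition walk_travs (W : seq (H * H)) : seq (H * H) :=
  zip (map snd W) (map fst (rot 1 W)).

Definition closed_walk (Hs : {set H}) (E : {set {set H}}) (eps : H -> V)
    (W : seq (H * H)) : bool :=
  all (dst Hs eps) W && all (fun t => [set t.1; t.2] \in E) (walk_travs W).

Definition walk_halfedges (W : seq (H * H)) : seq H :=
  flatten [seq [:: p.1; p.2] | p <- W].

Definition circuit (Hs : {set H}) (E : {set {set H}}) (eps : H -> V)
    (W : seq (H * H)) : bool :=
  [&& W != [::], closed_walk Hs E eps W & uniq (walk_halfedges W)].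

Definition walk_edges (W : seq (H * H)) : {set {set H}} :=
  [set [set t.1; t.2] | t in walk_travs W].

Definition forest (E : {set {set H}}) (eps : H -> V) (T : {set {set H}}) : Prop :=
  T \subset E /\
  forall W, circuit setT E eps W -> ~~ (walk_edges W \subset T).

Definition maximal_forest (E : {set {set H}}) (eps : H -> V) (T : {set {set H}}) : Prop :=
  forest E eps T /\
  forall T', forest E eps T' -> T \subset T' -> T' = T.

Definition strictly_fundamental_basis (E : {set {set H}}) (eps : H -> V)
    (B : seq (seq (H * H))) : Prop :=
  exists (T : {set {set H}}) (es : seq {set H}),
    [/\ maximal_forest E eps T,
        perm_eq es (enum (E :\: T)) &
        all2 (fun W e => circuit setT E eps W && (walk_edges W :\: T == [set e]))
             B es].

Definition circuit_partition (E : {set {set H}}) (eps : H -> V)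
    (P : seq (seq (H * H))) : bool :=
  all (circuit setT E eps) P &&
  [forall h : H,
     (\sum_(c <- P) count (fun p : H * H => (p.1 == h) || (p.2 == h)) c == 1)%N].

Definition sts (P : seq (seq (H * H))) : {set {set H}} :=
  [set [set p.1; p.2] | p in flatten P].

Definition is_transition (eps : H -> V) (T : {set {set H}}) : bool :=
  [exists v : V, partition T [set h | eps h == v] && [forall s in T, #|s| == 2]].

Definition Tch_edges (eps : H -> V) (P : seq (seq (H * H))) : {set {set {set H}}} :=
  [set T : {set {set H}} | is_transition eps T & T \subset sts P].

Definition Tch_halfedges (P : seq (seq (H * H))) : {set {set H}} := sts P.

(* incidence map of Tch(P): a single transition is mapped to (the index in P of)
   the circuit containing it; vertices of Tch(P) are the indices 0..size P - 1 *)
Definition Tch_eps (P : seq (seq (H * H))) (s : {set H}) : nat :=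
  find (fun c => s \in sts [:: c]) P.

Definition stP (P : seq (seq (H * H))) (h : H) : {set H} :=
  odflt set0 [pick s in sts P | h \in s].

(* pi_P(W), given as its sequence of edge traversals (s, s') in Tch(P)
   (edge {s,s'} traversed from half-edge s to half-edge s') *)
Definition pi_P (P : seq (seq (H * H))) (W : seq (H * H)) : seq ({set H} * {set H}) :=
  [seq (stP P p.1, stP P p.2) | p <- W & stP P p.1 != stP P p.2].

End Graphs.

Section Matrices.
Context {X : finType}.

(* directed version: in each edge exactly one half-edge is the tail *)
Definition directed_version (E : {set {set X}}) (dir : X -> bool) : Prop :=
  forall e, e \in E -> #|[set h in e | dir h]| = 1.

Definition sigma_trav (dir : X -> bool) (Tr : seq (X * X)) (e : {set X}) : int :=
  (\sum_(t <- Tr | [set t.1; t.2] == e) (if dir t.1 then 1 else -1))%R.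

Definition sigma (dir : X -> bool) (W : seq (X * X)) (e : {set X}) : int :=
  sigma_trav dir (walk_travs W) e.

Definition CM_trav (Gamma : seq (seq (X * X))) (dir : X -> bool) :
    'I_(size Gamma) -> {set X} -> int :=
  fun i e => sigma_trav dir (nth [::] Gamma i) e.

Arguments CM_trav : clear implicits.

Definition CM (Gamma : seq (seq (X * X))) (dir : X -> bool) :=
  CM_trav (map walk_travs Gamma) dir.
End Matrices.
Arguments CM_trav {X} Gamma dir.
Arguments CM {X} Gamma dir.

Definition totally_unimodular {m : nat} {C : finType}
    (M : 'I_m -> C -> int) (Cs : {set C}) : Prop :=
  forall (k : nat) (f : 'I_k -> 'I_m) (g : 'I_k -> C),
    injective f -> injective g -> (forall j, g j \in Cs) ->
    (\det (\matrix_(i, j) M (f i) (g j)) \in [:: 0; 1; -1])%R.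

(* Main.v *)
Require Import Defs.
From mathcomp Require Import all_boot all_order all_algebra.
From mathcomp Require Import zify.
Set Implicit Arguments.
Unset Strict Implicit.
Unset Printing Implicit Defensive.
Import GRing.Theory Num.Theory.
Local Open Scope ring_scope.

(** Splitting every vertex of F into its two single transitions in P, joined by
    a new edge, turns CM(Tch(P), pi_P(B), D) into the part of a network matrix
    whose columns are the new edges: the entry at (W, tau) is the net flow of W
    into the tail of tau.  If a minor is divisible by a prime p, there is a
    nonzero F_p-flow supported on the tree and the chosen cotree edges that
    avoids the chosen new edges.  Its support contains a circuit, hence also
    supports a nonzero integral flow; this flow is an integral combination of
    the fundamental ones, so the minor is zero.  Thus every nonzero minor is
    1 or -1. *)

(** * Flows and circuits *)

Section Flows.
Variables (H : finType) (V : eqType) (eps : H -> V) (mate : H -> H).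

(* [x h] is the amount that enters the vertex [eps h] through [h]. *)
Definition flow (K : zmodType) (x : H -> K) : Prop :=
  (forall h, x (mate h) = - x h) /\
  (forall v, \sum_(h | eps h == v) x h = 0).

(** A step enters a vertex through its first half-edge and leaves through its second, hence the
    signs. *)
Definition walk_flow (W : seq (H * H)) (h : H) : int :=
  \sum_(p <- W) ((p.1 == h)%:R - (p.2 == h)%:R).

Lemma walk_flow_sum (W : seq (H * H)) (A : pred H) :
  \sum_(h | A h) walk_flow W h = \sum_(p <- W) ((A p.1)%:R - (A p.2)%:R).
Proof.
rewrite exchange_big /=; apply: eq_bigr => p _.
have E (a : H) : \sum_(h | A h) (a == h)%:R = (A a)%:R :> int.
  case: (boolP (A a)) => Aa; last first.
    by rewrite big1 // => h Ah; case: eqP Ah Aa => // <- ->.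
  rewrite (bigD1 a) //= eqxx big1 ?addr0 // => h /andP[_ /negbTE].
  by rewrite eq_sym => ->.
by rewrite sumrB !E.
Qed.

Lemma walk_travs_fst (W : seq (H * H)) : map fst (walk_travs W) = map snd W.
Proof. by rewrite -/unzip1 unzip1_zip // !size_map size_rot. Qed.

Lemma walk_travs_snd (W : seq (H * H)) :
  perm_eq (map snd (walk_travs W)) (map fst W).
Proof.
rewrite -/unzip2 unzip2_zip ?size_map ?size_rot // map_rot.
by rewrite perm_rot perm_refl.
Qed.

Lemma mem_walk_halfedges (W : seq (H * H)) (h : H) :
  (h \in walk_halfedges W) = (h \in map fst W) || (h \in map snd W).
Proof.
rewrite /walk_halfedges; elim: W => //= p W IH.
by rewrite !inE IH; case: (h == p.1); case: (h == p.2); case: (h \in map fst W).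
Qed.

(** Regrouping by edge traversals instead of steps only permutes the summands, as [walk_travs] is a
    cyclic shift. *)
Lemma walk_flow_travs (W : seq (H * H)) (h : H) :
  walk_flow W h = \sum_(t <- walk_travs W) ((t.2 == h)%:R - (t.1 == h)%:R).
Proof.
rewrite /walk_flow !sumrB; congr (_ - _).
  rewrite -(big_map fst xpredT (fun a => (a == h)%:R : int)).
  rewrite -(big_map snd xpredT (fun a => (a == h)%:R : int)).
  by rewrite (perm_big _ (walk_travs_snd W)).
rewrite -(big_map snd xpredT (fun a => (a == h)%:R : int)).
by rewrite -(big_map fst xpredT (fun a => (a == h)%:R : int)) walk_travs_fst.
Qed.

Lemma walk_flow_eq0 (W : seq (H * H)) (h : H) :
  h \notin walk_halfedges W -> walk_flow W h = 0.
Proof.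
rewrite mem_walk_halfedges => /norP[h1 h2].
rewrite /walk_flow big_seq big1 // => p pW.
have /negbTE-> : p.1 != h by apply: contraNneq h1 => <-; apply: map_f.
by have /negbTE-> : p.2 != h by apply: contraNneq h2 => <-; apply: map_f.
Qed.

Lemma walk_flow_exit (W : seq (H * H)) (h : H) :
  uniq (walk_halfedges W) -> h \in map snd W -> walk_flow W h = -1.
Proof.
elim: W => //= p W IH; rewrite inE => /and3P[].
rewrite inE => /norP[p12 p1W] p2W uW.
rewrite /walk_flow big_cons -/(walk_flow W h) => /orP[/eqP->|hW].
  by rewrite eqxx (negbTE p12) walk_flow_eq0 ?addr0 // sub0r.
have hhW : h \in walk_halfedges W by rewrite mem_walk_halfedges hW orbT.
have /negbTE-> : p.1 != h by apply: contraNneq p1W => ->.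
have /negbTE-> : p.2 != h by apply: contraNneq p2W => ->.
by rewrite subrr add0r IH.
Qed.

Hypothesis mateK : involutive mate.

Definition steps (W : seq (H * H)) : bool :=
  all (fun p => (p.1 != p.2) && (eps p.1 == eps p.2)) W.

(** Antisymmetry is read off the edge traversals, conservation off the steps. *)
Lemma walk_flowP (W : seq (H * H)) :
  steps W -> all (fun t => t.2 == mate t.1) (walk_travs W) -> flow (walk_flow W).
Proof.
move=> /allP sW /allP tW; split=> [h|v].
  rewrite !walk_flow_travs -sumrN !big_seq; apply: eq_bigr => t /tW /eqP ->.
  rewrite opprB (inj_eq (can_inj mateK)); congr (_ - _).
  by rewrite -{1}(mateK t.1) (inj_eq (can_inj mateK)).
rewrite walk_flow_sum big_seq big1 // => p /sW /andP[_ /eqP->].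
by rewrite subrr.
Qed.

(** Steps at distinct vertices cannot share a half-edge. *)
Lemma uniq_walk_halfedges (W : seq (H * H)) :
  steps W -> uniq [seq eps p.1 | p <- W] -> uniq (walk_halfedges W).
Proof.
elim: W => //= p W IH /andP[/andP[p12 /eqP ep] sW] /andP[pW uW].
have nW h : eps h = eps p.1 -> h \notin walk_halfedges W.
  move=> eh; apply: contra pW; rewrite -eh mem_walk_halfedges => /orP[] /mapP[q qW ->].
    by apply/mapP; exists q.
  by apply/mapP; exists q => //; have /andP[_ /eqP] := allP sW _ qW.
by rewrite !inE (negbTE p12) !nW // IH.
Qed.

(* Leave every vertex through a half-edge of the support other than the one
   used to enter it, until a vertex repeats. *)
Lemma flow_support_circuit (K : zmodType) (z : H -> K) (h0 : H) :
  flow z -> (forall h, z h != 0 -> mate h != h) -> z h0 != 0 ->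
  exists W, [/\ W != [::], steps W, uniq (walk_halfedges W) &
    all (fun t => (z t.1 != 0) && (t.2 == mate t.1)) (walk_travs W)].
Proof.
move=> [zmate zsum] matez zh0.
pose ex h := odflt h [pick h' | [&& z h' != 0, h' != h & eps h' == eps h]].
(* If [h] were the only half-edge of the support at its vertex, conservation would force [z h = 0];
   so the default in [ex] is not reached here. *)
have exP h : z h != 0 -> [/\ z (ex h) != 0, ex h != h & eps (ex h) = eps h].
  move=> zh; rewrite /ex; case: pickP => [h' /and3P[? ? /eqP ?] //|none].
  have := zsum (eps h); rewrite (bigD1 h) //= big1 ?addr0 => [/eqP|h' /andP[e n]].
    by rewrite (negbTE zh).
  by apply/eqP; have := none h'; rewrite e n /= andbT => /negbFE.
(* [hs n] enters the vertex number [n] of the walk and [ex (hs n)] leaves it. *)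
pose hs n := iter n (mate \o ex) h0.
have hsS n : hs n.+1 = mate (ex (hs n)) by [].
have zhs n : z (hs n) != 0.
  by elim: n => // n /exP[? _ _]; rewrite hsS zmate oppr_eq0.
have zex n : z (ex (hs n)) != 0 by case: (exP _ (zhs n)).
have exN n : ex (hs n) != hs n by case: (exP _ (zhs n)).
have eex n : eps (ex (hs n)) = eps (hs n) by case: (exP _ (zhs n)).
(* Pigeonhole on half-edges: among [#|H|.+1] entries one repeats, and so does its vertex. *)
have rep : exists m, [exists i : 'I_m, eps (hs i) == eps (hs m)].
  have : ~~ injectiveb (fun i : 'I_#|H|.+1 => hs i).
    apply/injectiveP => /leq_card; rewrite card_ord; by rewrite ltnn.
  case/injectivePn => i [j nij eij].
  case: (ltngtP i j) => ij; last by rewrite (val_inj ij) eqxx in nij.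
    by exists j; apply/existsP; exists (Ordinal ij); rewrite /= eij.
  by exists i; apply/existsP; exists (Ordinal ij); rewrite /= eij.
case: (ex_minnP rep) => m /existsP[[i im] /= /eqP eim] minm.
have inj k l : (k < m)%N -> (l < m)%N -> eps (hs k) = eps (hs l) -> k = l.
  wlog kl : k l / (k < l)%N.
    move=> wl km lm e; case: (ltngtP k l) => // kl; first exact: wl.
    by apply/esym/wl.
  move=> km lm e; have : (m <= l)%N.
    by apply: minm; apply/existsP; exists (Ordinal kl); rewrite /= e.
  by rewrite leqNgt lm.
have [n mE] : exists n, m = (i + n.+1)%N.
  by exists (m - i.+1)%N; rewrite addnS -addSn subnKC.
(* The cycle is closed by replacing the entry [hs i] with [hs m], which lies at the same vertex. *)
pose W := (hs m, ex (hs i)) :: [seq (hs k, ex (hs k)) | k <- iota i.+1 n].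
have stW : walk_travs W = [seq (ex (hs k), hs k.+1) | k <- iota i n.+1].
  transitivity (zip [seq ex (hs k) | k <- iota i n.+1]
                    [seq hs k.+1 | k <- iota i n.+1]); last by rewrite zip_map.
  congr zip; first by rewrite /= -map_comp.
  rewrite rot1_cons map_rcons -map_comp (map_comp hs succn) -(iotaDl 1) add1n.
  by rewrite -(addn1 n) iotaD map_cat cats1 /= mE addnS.
(* The closing step cannot backtrack. For a loop, [mate] has no fixed point on the support;
   otherwise the last exit would be [hs i.+1], so by [inj] the last vertex has index [i.+1] and is
   left through its own entry. *)
have hm : hs m != ex (hs i).
  rewrite mE addnS hsS; case: n {stW W} mE => [|n] mE.
    by rewrite addn0 matez.
  apply/eqP => e; have e2 : ex (hs (i + n.+1)) = hs i.+1 by rewrite hsS -e mateK.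
  have : (i + n.+1)%N = i.+1.
    by apply: inj; rewrite ?mE ?addnS ?ltnS // -?addSn ?leq_addr // -e2 addSn -addnS eex.
  by move=> e3; have := exN (i + n.+1)%N; rewrite e2 e3 eqxx.
have sW : steps W.
  rewrite /steps /= hm -eim eex eqxx /=; apply/allP => p /mapP[k _ ->] /=.
  by rewrite eex eqxx eq_sym exN.
exists W; split => //; last first.
  by rewrite stW; apply/allP => t /mapP[k _ ->] /=; rewrite zex eqxx.
apply: uniq_walk_halfedges => //.
have -> : [seq eps p.1 | p <- W] = [seq eps (hs k) | k <- iota i n.+1].
  by rewrite /= -eim -map_comp.
rewrite map_inj_in_uniq ?iota_uniq // => k l.
by rewrite !mem_iota -mE => /andP[_ km] /andP[_ lm]; apply: inj.
Qed.

End Flows.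

(** * Splitting the vertices along a partition into single transitions *)

Section Split.
Variables (V H : finType) (eps : H -> V) (mate : H -> H) (Q : {set {set H}}).
Hypotheses (mateK : involutive mate) (mateN : forall h, mate h != h).
Hypothesis eps4 : four_regular eps.
Hypotheses (partQ : partition Q setT) (Q2 : forall s, s \in Q -> #|s| = 2).
Hypothesis Qeps : forall s a b, s \in Q -> a \in s -> b \in s -> eps a = eps b.

Local Notation star v := [set h | eps h == v].
(** For a block [s] this is the other single transition at its vertex, which [eps @: s] recovers. *)
Let co (s : {set H}) : {set H} := [set h | (h \notin s) && (eps h \in eps @: s)].

Let trivQ : trivIset Q. Proof. by case/and3P: partQ. Qed.
Let coverQ h : h \in cover Q.
Proof. by case/and3P: partQ => /eqP-> _ _; rewrite inE. Qed.
Let blockQ h : pblock Q h \in Q. Proof. exact: pblock_mem. Qed.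
Let mem_blockQ h : h \in pblock Q h. Proof. by rewrite mem_pblock. Qed.

Lemma pblock_eq s h : s \in Q -> (pblock Q h == s) = (h \in s).
Proof.
move=> sQ; apply/eqP/idP => [<- //|hs]; exact: def_pblock.
Qed.

Let block_star s h : s \in Q -> h \in s -> s \subset star (eps h).
Proof. by move=> sQ hs; apply/subsetP => k ks; rewrite inE (Qeps sQ ks hs). Qed.

Let coE s h : s \in Q -> h \in s -> co s = star (eps h) :\: s.
Proof.
move=> sQ hs; apply/setP => k; rewrite !inE; congr (_ && _).
apply/imsetP/eqP => [[l ls ->]|->]; last by exists h.
exact: Qeps ls hs.
Qed.

Let block_pick s : s \in Q -> exists h, h \in s.
Proof. by move=> sQ; apply/set0Pn; rewrite -card_gt0 Q2. Qed.

Let card_co s : s \in Q -> #|co s| = 2.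
Proof.
move=> sQ; have [h hs] := block_pick sQ.
by rewrite (coE sQ hs) cardsDS ?block_star // eps4 Q2.
Qed.

(** A block meeting [co s] stays at the same vertex and is disjoint from [s], so it lies inside
    [co s]; both have two elements. *)
Let co_block s : s \in Q -> co s \in Q.
Proof.
move=> sQ; have [h hs] := block_pick sQ.
have [c cs] : exists c, c \in co s by apply/set0Pn; rewrite -card_gt0 card_co.
suff -> : co s = pblock Q c by [].
apply/esym/eqP; rewrite eqEcard card_co // Q2 // leqnn andbT.
move: (cs); rewrite (coE sQ hs) !inE => /andP[cNs /eqP ce].
apply/subsetP => k kc; rewrite !inE -ce (Qeps (blockQ c) kc (mem_blockQ c)) eqxx andbT.
apply: contra cNs => ks; have := kc; rewrite -pblock_eq // => /eqP e.
by move: ks; rewrite -pblock_eq // e pblock_eq.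
Qed.

Let coK s : s \in Q -> co (co s) = s.
Proof.
move=> sQ; have [h hs] := block_pick sQ.
have [c cs] := block_pick (co_block sQ).
rewrite (coE (co_block sQ) cs) (coE sQ hs).
move: cs; rewrite (coE sQ hs) !inE => /andP[_ /eqP ->].
by rewrite setDDr setDv set0U; apply/setIidPr/block_star.
Qed.

Let co_neq s : s \in Q -> co s != s.
Proof.
move=> sQ; have [h hs] := block_pick sQ.
by apply/eqP => /setP/(_ h); rewrite (coE sQ hs) !inE hs.
Qed.

Let star_sum (K : zmodType) (x : H -> K) s h : s \in Q -> h \in s ->
  \sum_(k | eps k == eps h) x k = \sum_(k in s) x k + \sum_(k in co s) x k.
Proof.
move=> sQ hs; rewrite (coE sQ hs) (bigID (mem s)) /=; congr (_ + _).
  apply: eq_bigl => k; rewrite andbC; case: (boolP (k \in s)) => //= ks.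
  by rewrite (Qeps sQ ks hs) eqxx.
by apply: eq_bigl => k; rewrite !inE andbC.
Qed.

(* The 3-regular graph in which every vertex is split into its two
   blocks s and [co s], joined by a new edge {inr s, inr (co s)}. *)
Let seps (x : H + {set H}) : {set H} :=
  match x with inl h => pblock Q h | inr s => s end.
(** A set outside [Q] belongs to no new edge: it is its own mate, and lifted flows vanish on it. *)
Let smate (x : H + {set H}) : H + {set H} :=
  match x with inl h => inl (mate h) | inr s => inr (if s \in Q then co s else s) end.

Let smateK : involutive smate.
Proof.
case=> [h|s] /=; first by rewrite mateK.
by case: (boolP (s \in Q)) => [sQ|/negbTE->//]; rewrite co_block // coK.
Qed.

Let seps_sum (K : zmodType) (x : H + {set H} -> K) s :
  \sum_(y | seps y == s) x y = \sum_(h | pblock Q h == s) x (inl h) + x (inr s).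
Proof. by rewrite big_sumType /= big_pred1_eq. Qed.

(** Lift [z] to the split graph, take a circuit in the support of the lift, and restrict its
    integral flow to [H]. The new edges are part of the support, so vanishing block sums are
    inherited. *)
Lemma transfer_flow (K : zmodType) (z : H -> K) (h0 : H) :
  flow eps mate z -> z h0 != 0 ->
  exists y : H -> int, [/\ flow eps mate y, exists h, y h != 0,
    forall h, z h = 0 -> y h = 0 &
    forall s, s \in Q -> \sum_(h in s) z h = 0 -> \sum_(h in s) y h = 0].
Proof.
move=> [zmate zsum] zh0.
(* Conservation at the split vertex [s] forces the value on [inr s]. *)
pose z' (x : H + {set H}) :=
  match x with inl h => z h | inr s => - \sum_(h | pblock Q h == s) z h end.
have blk (L : zmodType) (y : H -> L) s :
    s \in Q -> \sum_(h | pblock Q h == s) y h = \sum_(h in s) y h.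
  by move=> sQ; apply: eq_bigl => h; rewrite pblock_eq.
have blkN (L : zmodType) (y : H -> L) s :
    s \notin Q -> \sum_(h | pblock Q h == s) y h = 0.
  by move=> sQ; rewrite big_pred0 // => h; apply: contraNF sQ => /eqP <-.
have z'flow : flow seps smate z'.
  split=> [[h|s] //=|s]; last by rewrite seps_sum /= subrr.
  case: ifP => sQ; last by rewrite blkN ?sQ // !oppr0.
  (* On a new edge, antisymmetry amounts to conservation of [z] at the original vertex. *)
  have [h hs] := block_pick sQ.
  rewrite !blk ?co_block //; apply/eqP; rewrite eqr_oppLR opprK -addr_eq0 addrC.
  by rewrite -(star_sum _ sQ hs) zsum.
have z'N x : z' x != 0 -> smate x != x.
  case: x => [h _|s] /=; first by apply: contra (mateN h) => /eqP[->].
  rewrite oppr_eq0; case: ifP => sQ; last by rewrite blkN ?sQ ?eqxx.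
  by move=> _; apply: contra (co_neq sQ) => /eqP[->].
have [W [W0 sW uW tW]] :=
  @flow_support_circuit _ _ seps smate smateK _ z' (inl h0) z'flow z'N zh0.
have [wmate wsum] : flow seps smate (walk_flow W).
  by apply: walk_flowP => //; apply: sub_all tW => t /andP[].
have wsupp x : z' x = 0 -> walk_flow W x = 0.
  move=> zx; apply: walk_flow_eq0; apply/negP.
  have tz t : t \in walk_travs W -> (z' t.1 != 0) && (z' t.2 != 0).
    move=> /(allP tW) /andP[zt /eqP ->]; rewrite zt /=.
    by case: z'flow => -> _; rewrite oppr_eq0.
  rewrite mem_walk_halfedges => /orP[].
    rewrite -(perm_mem (walk_travs_snd W)) => /mapP[t tin xt].
    by have /andP[_] := tz _ tin; rewrite -xt zx eqxx.
  rewrite -walk_travs_fst => /mapP[t tin xt].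
  by have /andP[] := tz _ tin; rewrite -xt zx eqxx.
pose y h := walk_flow W (inl h).
have wr s : walk_flow W (inr s) = - \sum_(h | pblock Q h == s) y h.
  by apply/eqP; rewrite -addr_eq0 addrC -seps_sum wsum.
exists y; split => [|||s sQ zs].
- split=> [h|v]; first by rewrite /y -wmate.
  case: (pickP (fun h => eps h == v)) => [h /eqP <-|none]; last by rewrite big_pred0.
  rewrite (star_sum _ (blockQ h) (mem_blockQ h)) -!blk ?co_block //.
  have := wmate (inr (pblock Q h)); rewrite /= blockQ !wr opprK => <-.
  by rewrite addNr.
(* If [y] vanished, conservation would kill the flow on the new edges too, but it is -1 at an exit
   of the circuit. *)
- apply/existsP; rewrite -negb_forall; apply/negP => /forallP y0.
  have w0 x : walk_flow W x = 0.
    case: x => [h|s]; first exact/eqP/y0.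
    by rewrite wr big1 ?oppr0 // => h _; apply/eqP/y0.
  case: W W0 uW w0 {sW tW wmate wsum wsupp y wr y0} => // p W _ uW w0.
  by have := walk_flow_exit uW (mem_head _ _); rewrite w0.
- by move=> h; exact: (wsupp (inl h)).
apply/eqP; rewrite -blk // -oppr_eq0 -wr; apply/eqP/wsupp.
by rewrite /= blk // zs oppr0.
Qed.

(** In the intended use [x i] is the flow of a fundamental circuit, [a i] the half-edge through
    which it sets out along its cotree edge, and [A] the set of half-edges of the forest. *)
Lemma fundamental_flow_minor (k : nat) (x : 'I_k -> H -> int) (a : 'I_k -> H)
    (A : {set H}) (s : 'I_k -> {set H}) :
  (forall i, flow eps mate (x i)) ->
  (forall i, x i (a i) = -1) ->
  (forall i j, i != j -> x i (a j) = 0) ->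
  (forall i h, x i h != 0 -> [|| h \in A, h == a i | h == mate (a i)]) ->
  (forall y : H -> int, flow eps mate y -> (forall h, h \notin A -> y h = 0) ->
     forall h, y h = 0) ->
  (forall j, s j \in Q) ->
  \det (\matrix_(i, j) \sum_(h in s j) x i h) \in [:: 0; 1; -1].
Proof.
move=> xflow xaa xab xsupp acyclic sQ.
set N := \matrix_(i, j) _.
rewrite !inE; apply/orP; case: (eqVneq (\det N) 0) => [|N0]; first by left.
right; apply: contraT => N1.
have [p pp pN] : exists2 p, prime p & (p %| `|\det N|)%N.
  by exists (pdiv `|\det N|); rewrite ?pdiv_dvd ?pdiv_prime //; move: N0 N1; lia.
have /det0P[u u0 uN] : \det (map_mx (intr : int -> 'F_p) N) == 0.
  rewrite det_map_mx.
  have /dvdzP[q ->] : (p %| \det N)%Z by rewrite dvdzE.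
  by rewrite rmorphM /= -pmulrn pchar_Fp_0 // mulr0.
(* As [u] is in the left kernel modulo [p], this flow has sum zero on each [s j]; its values at the
   [a i] are the negated entries of [u]. *)
pose z h : 'F_p := \sum_i u 0 i * (x i h)%:~R.
have za i : z (a i) = - u 0 i.
  rewrite /z (bigD1 i) //= xaa big1 ?addr0 ?mulrN1 // => j ji.
  by rewrite xab ?mulr0.
have zflow : flow eps mate z.
  split=> [h|v].
    rewrite /z -sumrN; apply: eq_bigr => i _.
    by case: (xflow i) => -> _; rewrite rmorphN mulrN.
  rewrite exchange_big big1 //= => i _; rewrite -mulr_sumr -rmorph_sum.
  by case: (xflow i) => _ ->; rewrite mulr0.
have [i ui] : exists i, u 0 i != 0.
  apply/existsP; rewrite -negb_forall; apply: contra u0 => /forallP u0.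
  by apply/eqP/rowP => i; rewrite mxE; apply/eqP.
have zi : z (a i) != 0 by rewrite za oppr_eq0.
have [y [yflow [h yh] yz ys]] := transfer_flow zflow zi.
(* The plus sign comes from [x i (a i) = -1]: [r] vanishes at every [a j]. *)
pose r g := y g + \sum_i y (a i) * x i g.
have rflow : flow eps mate r.
  split=> [g|v].
    case: yflow => ym _; rewrite /r ym opprD -sumrN; congr (_ + _).
    by apply: eq_bigr => j _; case: (xflow j) => -> _; rewrite mulrN.
  case: yflow => _ yv; rewrite big_split /= yv add0r exchange_big big1 //= => j _.
  by rewrite -mulr_sumr; case: (xflow j) => _ ->; rewrite mulr0.
have ra j : r (a j) = 0.
  rewrite /r (bigD1 j) //= xaa big1 ?addr0 ?mulrN1 ?subrr // => l lj.
  by rewrite xab ?mulr0.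
(* Outside [A], [r] vanishes on the chosen cotree edges by [ra] and antisymmetry; elsewhere all
   [x j] vanish, hence [z], hence [y]. *)
have r0 : forall g, r g = 0.
  apply: acyclic => // g gA; case: (pickP (fun j => x j g != 0)) => [j xj|none].
    have := xsupp _ _ xj; rewrite (negbTE gA) /= => /orP[] /eqP -> //.
    by case: rflow => -> _; rewrite ra oppr0.
  have x0 j : x j g = 0 by apply/eqP/negbFE/none.
  rewrite /r big1 ?addr0 => [|j _]; last by rewrite x0 mulr0.
  by apply: yz; rewrite /z big1 // => j _; rewrite x0 mulr0.
have yE g : y g = - \sum_i y (a i) * x i g.
  by apply/eqP; rewrite -addr_eq0 -/(r g) r0.
pose w := \row_i y (a i).
have wN : w *m N = 0.
  apply/rowP => j; rewrite [LHS]mxE [RHS]mxE.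
  (* The ring is left general because this exchange of sums serves both modulo [p] and over the
     integers. *)
  have NE (L : comPzRingType) (c : 'I_k -> L) (f : {rmorphism int -> L}) :
      \sum_i c i * f (N i j) = \sum_(h in s j) \sum_i c i * f (x i h).
    rewrite exchange_big; apply: eq_bigr => i' _.
    by rewrite mxE rmorph_sum mulr_sumr.
  have zs : \sum_(h in s j) z h = 0.
    transitivity ((u *m map_mx intr N) 0 j); last by rewrite uN mxE.
    rewrite mxE.
    apply: etrans (esym (NE _ (u 0) intr)) _.
    by apply: eq_bigr => l _; rewrite [map_mx _ _ _ _]mxE.
  transitivity (- \sum_(h in s j) y h); last by rewrite ys ?oppr0.
  under [in RHS]eq_bigr do rewrite yE.
  rewrite sumrN opprK; apply: etrans (NE _ (fun i => y (a i)) idfun).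
  by apply: eq_bigr => l _; rewrite [w _ _]mxE.
(* Multiplying by the adjugate gives [\det N] times [w]; then [w = 0] makes [y] zero. *)
have w0 : w = 0.
  have : w *m N *m \adj N = 0 by rewrite wN mul0mx.
  rewrite -mulmxA mul_mx_adj mul_mx_scalar => /eqP.
  by rewrite scalemx_eq0 (negbTE N0) => /eqP.
move: yh; rewrite yE big1 ?oppr0 ?eqxx // => j _.
by have /rowP/(_ j) := w0; rewrite !mxE => ->; rewrite mul0r.
Qed.
End Split.

(** * Circuits and circuit partitions of a 4-regular graph *)

Section Graph.
Variables (V H : finType) (E : {set {set H}}) (eps : H -> V).
Hypothesis graphE : is_graph setT E.

(** In a graph every half-edge lies in a two-element edge, so the default is never reached. *)
Definition edge_mate (h : H) : H := odflt h [pick h' | [set h; h'] \in E].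
Local Notation mate := edge_mate.

Lemma card_edge e : e \in E -> #|e| = 2.
Proof. by case/andP: graphE => _ /forall_inP E2 /E2 /eqP. Qed.

Lemma edge_mateE h : [set h; mate h] \in E.
Proof.
rewrite /mate; case: pickP => [//|none].
have hE : h \in cover E by case/andP: graphE => /and3P[/eqP-> _ _] _; rewrite inE.
have := pblock_mem hE; have := hE; rewrite -mem_pblock => + bE.
have /eqP/cards2P[a [b [_ ab]]] := card_edge bE.
rewrite ab; rewrite ab in bE; rewrite !inE => /orP[] /eqP e.
  by have := none b; rewrite e bE.
by have := none a; rewrite e setUC bE.
Qed.

Lemma edge_mate_neq h : mate h != h.
Proof.
have := card_edge (edge_mateE h).
by rewrite cards2; case: eqP => // /eqP; rewrite eq_sym.
Qed.

Lemma edge_mate_unique h h' : [set h; h'] \in E -> h' = mate h.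
Proof.
move=> hE; have hh' : h' != h.
  by have := card_edge hE; rewrite cards2; case: eqP => // /eqP; rewrite eq_sym.
have trivE : trivIset E by case/andP: graphE => /and3P[].
have : h' \in [set h; mate h].
  rewrite -(def_pblock trivE (edge_mateE h) (set21 _ _)).
  by rewrite (def_pblock trivE hE (set21 _ _)) set22.
by rewrite !inE (negbTE hh') => /eqP.
Qed.

Lemma edge_mateK : involutive mate.
Proof. by move=> h; apply/esym/edge_mate_unique; rewrite setUC edge_mateE. Qed.

Lemma circuitP W : circuit setT E eps W =
  [&& W != [::], steps eps W, all (fun t => t.2 == mate t.1) (walk_travs W)
    & uniq (walk_halfedges W)].
Proof.
rewrite /circuit /closed_walk -andbA; congr [&& _, _, _ & _].
  by apply: eq_all => p; rewrite /dst !inE.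
apply: eq_all => t; apply/idP/eqP => [|->]; first exact: edge_mate_unique.
exact: edge_mateE.
Qed.

Lemma circuit_flow W : circuit setT E eps W -> flow eps mate (walk_flow W).
Proof.
rewrite circuitP => /and4P[_ sW tW _].
by apply: walk_flowP; first exact: edge_mateK.
Qed.

Lemma walk_edges_support W h : circuit setT E eps W ->
  walk_flow W h != 0 -> [set h; mate h] \in walk_edges W.
Proof.
rewrite circuitP => /and4P[_ _ /allP tW _] Wh.
have : h \in walk_halfedges W by apply: contraNT Wh => /walk_flow_eq0->.
rewrite mem_walk_halfedges -(perm_mem (walk_travs_snd W)) -(walk_travs_fst W).
case/orP=> /mapP[t tin ->]; apply/imsetP; exists t => //.
  by rewrite (eqP (tW _ tin)) edge_mateK setUC.
by rewrite (eqP (tW _ tin)).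
Qed.

(** The first half-edge of a traversal is an exit, and a circuit uses it only once. *)
Lemma walk_edges_exit W e : circuit setT E eps W -> e \in walk_edges W ->
  exists2 a, e = [set a; mate a] & walk_flow W a = -1.
Proof.
rewrite circuitP => /and4P[_ _ /allP tW uW] /imsetP[t tin ->].
exists t.1; first by rewrite (eqP (tW _ tin)).
by apply: walk_flow_exit => //; rewrite -walk_travs_fst map_f.
Qed.

(** The support of a nonzero flow would contain a circuit inside the forest. *)
Lemma forest_flow (K : zmodType) T (y : H -> K) : forest E eps T ->
  flow eps mate y -> (forall h, [set h; mate h] \notin T -> y h = 0) ->
  forall h, y h = 0.
Proof.
move=> [_ acyc] yflow yT h; apply/eqP; apply: contraT => yh.
have [W [W0 sW uW tW]] :=
  flow_support_circuit edge_mateK yflow (fun h _ => edge_mate_neq h) yh.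
have cW : circuit setT E eps W.
  by rewrite circuitP W0 sW uW andbT; apply: sub_all tW => t /andP[].
case/negP: (acyc _ cW); apply/subsetP => e /imsetP[t /(allP tW) /andP[yt /eqP ->] ->].
by apply: contraNT yt => /yT->.
Qed.

(** * Touch-graph of a circuit partition *)

Variable P : seq (seq (H * H)).
Hypothesis partP : circuit_partition E eps P.

Let touches (h : H) (p : H * H) := (p.1 == h) || (p.2 == h).

Lemma circuit_partition_step p : p \in flatten P ->
  p.1 != p.2 /\ eps p.1 = eps p.2.
Proof.
case/andP: partP => /allP cP _ /flattenP[W /cP].
by rewrite circuitP => /and4P[_ /allP sW _ _] /sW /andP[? /eqP].
Qed.

Lemma circuit_partition_count h : count (touches h) (flatten P) = 1%N.
Proof.
case/andP: partP => _ /forallP/(_ h) /eqP <-.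
by rewrite count_flatten sumnE big_map.
Qed.

Lemma touches_unique h p q : p \in flatten P -> q \in flatten P ->
  touches h p -> touches h q -> p = q.
Proof.
move=> pP qP hp hq; have := circuit_partition_count h; rewrite -size_filter.
have : p \in filter (touches h) (flatten P) by rewrite mem_filter hp.
have : q \in filter (touches h) (flatten P) by rewrite mem_filter hq.
by case: filter => [|r []] //; rewrite !inE => /eqP-> /eqP->.
Qed.

Let stepP s : reflect (exists2 p, p \in flatten P & s = [set p.1; p.2]) (s \in sts P).
Proof. exact: imsetP. Qed.

Let touchesE h (p : H * H) : (h \in [set p.1; p.2]) = touches h p.
Proof. by rewrite !inE /touches ![_ == h]eq_sym. Qed.

Lemma card_sts s : s \in sts P -> #|s| = 2.
Proof.
by case/stepP=> p /circuit_partition_step[n _] ->; rewrite cards2 n.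
Qed.

Lemma sts_eps s a b : s \in sts P -> a \in s -> b \in s -> eps a = eps b.
Proof.
case/stepP=> p /circuit_partition_step[_ e] ->.
by rewrite !inE => /orP[] /eqP-> /orP[] /eqP->.
Qed.

Lemma sts_partition : partition (sts P) setT.
Proof.
apply/and3P; split.
- apply/eqP/setP => h; rewrite inE; apply/bigcupP.
  have : has (touches h) (flatten P) by rewrite has_count circuit_partition_count.
  case/hasP => p pP ph; exists [set p.1; p.2]; last by rewrite touchesE.
  by apply/stepP; exists p.
- apply/trivIsetP => A B /stepP[p pP ->] /stepP[q qP ->]; apply: contraR.
  case/pred0Pn => h /andP[]; rewrite /= !touchesE => hp hq.
  by rewrite (touches_unique pP qP hp hq).
by apply/negP => /card_sts; rewrite cards0.
Qed.

Lemma stP_pblock h : stP P h = pblock (sts P) h.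
Proof.
have [/eqP covP trivP _] := and3P sts_partition.
rewrite /stP; case: pickP => [s /andP[sP hs] /=|none].
  exact/esym/def_pblock.
by have := none (pblock (sts P) h); rewrite pblock_mem ?mem_pblock ?covP ?inE.
Qed.

(** Take for [s] the tail of [tau]. A step of [W] traverses [tau] forward when it enters through [s]
    and leaves through the other block, backward in the opposite case, so both sides agree step by
    step. *)
Lemma sigma_tail_flow dir tau : four_regular eps -> directed_version (Tch_edges eps P) dir ->
  tau \in Tch_edges eps P ->
  exists2 s, s \in sts P & forall W, steps eps W ->
    sigma_trav dir (pi_P P W) tau = \sum_(h in s) walk_flow W h.
Proof.
move=> eps4 dirP tauP; have /eqP/cards1P[s tails] := dirP _ tauP.
have := tauP; rewrite inE => /andP[/existsP[v /andP[vtau /forall_inP tau2]] tauS].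
have [/eqP covtau trivtau _] := and3P vtau.
have [/eqP covP trivP _] := and3P sts_partition.
have /setP/(_ s) := tails; rewrite !inE eqxx => /andP[stau sdir].
have sP : s \in sts P by apply: (subsetP tauS).
have tautail t : t \in tau -> dir t = (t == s).
  by move=> ttau; have /setP/(_ t) := tails; rewrite !inE ttau.
have stE t h : t \in sts P -> (stP P h == t) = (h \in t).
  by move=> tP; rewrite stP_pblock (pblock_eq sts_partition).
have sttau h : (stP P h \in tau) = (eps h == v).
  apply/idP/idP => [htau|hv].
    have : h \in cover tau.
      apply/bigcupP; exists (stP P h) => //.
      by rewrite stP_pblock mem_pblock covP inE.
    by rewrite covtau inE.
  have : h \in cover tau by rewrite covtau inE.
  case/bigcupP => t ttau ht; suff /eqP-> : stP P h == t by [].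
  by rewrite stE // (subsetP tauS).
exists s => // W /allP sW.
rewrite walk_flow_sum /sigma_trav /pi_P big_map big_filter_cond big_mkcond /=.
rewrite [LHS]big_seq [RHS]big_seq; apply: eq_bigr => p /sW /andP[_ /eqP ep].
rewrite -!stE //.
(* Steps away from the vertex [v] of [tau] contribute nothing to either side. *)
have [pv|pv] := eqVneq (eps p.1) v; last first.
  have nt1 : stP P p.1 \notin tau by rewrite sttau.
  have nt2 : stP P p.2 \notin tau by rewrite sttau -ep.
  have /negbTE-> : stP P p.1 != s by apply: contraNneq nt1 => ->.
  have /negbTE-> : stP P p.2 != s by apply: contraNneq nt2 => ->.
  case: ifP => // /andP[_ /eqP e]; move: nt1.
  by rewrite -e set21.
have t1 : stP P p.1 \in tau by rewrite sttau pv.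
have t2 : stP P p.2 \in tau by rewrite sttau -ep pv.
(* A step within one block is deleted by [pi_P], and its entry and exit cancel in the block sum. *)
case: (eqVneq (stP P p.1) (stP P p.2)) => [->|n12] /=; first by rewrite subrr.
(* Four half-edges in blocks of two give two blocks, so two distinct ones exhaust [tau]. *)
have tauE : [set stP P p.1; stP P p.2] = tau.
  apply/eqP; rewrite eqEcard cards2 n12; apply/andP; split.
    by apply/subsetP => t; rewrite !inE => /orP[] /eqP->.
  have tau_unif : {in tau, forall A : {set H}, #|A| = 2} by move=> A /tau2 /eqP.
  have := card_uniform_partition tau_unif vtau.
  by rewrite eps4; case: #|tau| => [|[|[|m]]].
rewrite tauE eqxx.
rewrite tautail //; case: (eqVneq (stP P p.1) s) => [e1|n1].
  by have /negbTE-> : stP P p.2 != s by rewrite -e1 eq_sym.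
have : s \in [set stP P p.1; stP P p.2] by rewrite tauE.
by rewrite !inE ![s == _]eq_sym (negbTE n1) => /= ->.
Qed.

End Graph.

Theorem mainTheorem12 (V H : finType) (E : {set {set H}}) (eps : H -> V)
  (P : seq (seq (H * H))) (dir : {set H} -> bool) (B : seq (seq (H * H))) :
  is_graph setT E ->
  four_regular eps ->
  circuit_partition E eps P ->
  directed_version (Tch_edges eps P) dir ->
  strictly_fundamental_basis E eps B ->
  totally_unimodular (CM_trav (map (pi_P P) B) dir) (Tch_edges eps P).
Proof.
move=> graphE eps4 partP dirP [T [es [[forestT _] es_perm Bes]]] k f g f_inj _ gP.
have [s sQ sP] := fin_all_exists2 (fun j => sigma_tail_flow graphE partP eps4 dirP (gP j)).
move: Bes; rewrite all2E => /andP[/eqP size_es /(all_nthP ([::], set0)) Bes].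
pose W i := nth [::] B (f i); pose e i := nth set0 es (f i).
have ltB i : (f i < size B)%N by rewrite -(size_map (pi_P P)).
have circW i : circuit setT E eps (W i) /\ walk_edges (W i) :\: T = [set e i].
  have := Bes (f i); rewrite size_zip -size_es minnn nth_zip // => /(_ (ltB i)).
  by case/andP=> ? /eqP.
have eT i : e i \notin T.
  by case: (circW i) => _ /setP/(_ (e i)); rewrite !inE eqxx => /andP[].
have e_inj : injective e.
  move=> i j /eqP; rewrite nth_uniq -?size_es //.
    by move=> /eqP /val_inj /f_inj.
  by rewrite (perm_uniq es_perm) enum_uniq.
(* The half-edge through which [W i] sets out along its cotree edge will serve as [a i]. *)
have exit i : exists2 a, e i = [set a; edge_mate E a] & walk_flow (W i) a = -1.
  have [cW eW] := circW i; apply: (walk_edges_exit graphE cW).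
  by have /setP/(_ (e i)) := eW; rewrite !inE eqxx => /andP[].
have [a ea xa] := fin_all_exists2 exit.
have supp i h : walk_flow (W i) h != 0 ->
    ([set h; edge_mate E h] \in T) || ([set h; edge_mate E h] == e i).
  have [cW eW] := circW i => /(walk_edges_support graphE cW) hW.
  have /setP/(_ [set h; edge_mate E h]) := eW.
  by rewrite in_setD in_set1 hW andbT => <-; rewrite orbN.
(* The touch-graph entries become block sums of fundamental flows. *)
rewrite (_ : \matrix_(i, j) _ = \matrix_(i, j) \sum_(h in s j) walk_flow (W i) h).
  apply: (@fundamental_flow_minor _ _ _ _ (sts P) (edge_mateK graphE)
    (edge_mate_neq graphE) eps4 (sts_partition graphE partP)
    (card_sts graphE partP) (@sts_eps _ _ _ _ graphE _ partP) _ (fun i => walk_flow (W i)) a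
    [set h | [set h; edge_mate E h] \in T]) => // [i|i j ij|i h|y yflow yT].
  - by apply: circuit_flow => //; case: (circW i).
  - apply/eqP; apply: contraT => /supp; rewrite -ea (negbTE (eT j)) /=.
    by rewrite (inj_eq e_inj) eq_sym (negbTE ij).
  - case/supp/orP=> [|/eqP hE]; first by rewrite inE => ->.
    have : h \in e i by rewrite -hE set21.
    by rewrite ea !inE => ->; rewrite orbT.
  - by apply: (forest_flow graphE forestT yflow) => h hT; apply: yT; rewrite inE.
apply/matrixP => i j; rewrite !mxE /CM_trav (nth_map [::]) // sP //.
by have [+ _] := circW i; rewrite circuitP // => /and4P[].
Qed.
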